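(* Let $\xi,\xi_1,\xi_2,\ldots$ be independent identically distributed real random variables with finite mean and common distribution $F\in\mathcal S^*$. If ${\bf E}\xi<0$, then there exists a constant $K$ such that $$ \frac{\overline{F^{*n}}(x)}{\overline F(x)}\le Kn\quad\text{for all } n\ge 1\text{ and all } x\in{\bf R}. $$ If ${\bf E}\xi\in[0,\infty)$, then, for any $c>{\bf E}\xi$, there exists $K$ such that $$ \frac{\overline{F^{*n}}(x)}{\overline F(x)}\le\frac{K}{\overline F(cn)}\quad\text{for all } n\ge 1\text{ and all } x\in{\bf R}. $$
   Context: $\overline F(x)={\bf P}\{\xi>x\}$, and $F$ is right-unbounded: $\overline F(x)>0$ for all $x$. $F^{*n}$ is the distribution of $S_n=\xi_1+\cdots+\xi_n$, and $\overline{F^{*n}}(x)={\bf P}\{S_n>x\}$. A distribution $F$ on ${\bf R}$ with finite mean (and $\overline F(x)>0$ for all $x$) belongs to the class $\mathcal S^*$ if $\int_0^x\overline F(x-y)\overline F(y)\,dy\sim 2a\,\overline F(x)$ as $x\to\infty$ (ratio tends to $1$), where $a=\int_0^\infty\overline F(y)\,dy$. *)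

(* Defs.v *)
From HB Require Import structures.
From mathcomp Require Import all_boot all_order all_algebra.
From mathcomp Require Import all_classical all_reals all_analysis.
From mathcomp Require Import measurable_realfun.
Set Implicit Arguments.
Unset Strict Implicit.
Unset Printing Implicit Defensive.
Import Order.TTheory GRing.Theory Num.Theory.
Import numFieldNormedType.Exports.
Local Open Scope classical_set_scope.
Local Open Scope ring_scope.

(* Real-valued counterpart of the library's extended-real [ccdf]. *)
Definition tail (R : realType) (F : probability R R) (x : R) : R :=
  fine (F `]x, +oo[%classic).

Definition Sstar (R : realType) (F : probability R R) : Prop :=
  [/\ F.-integrable setT (fun x : R => x%:E),
      forall x : R, 0 < tail F x
    & let a := \int[lebesgue_measure]_(y in `[0, +oo[) tail F y in
      (\int[lebesgue_measure]_(y in `[0, x]) (tail F (x - y) * tail F y))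
        / (2 * a * tail F x) @[x --> +oo] --> (1 : R) ].

Definition mutually_independent (d : measure_display) (T : measurableType d)
    (R : realType) (P : probability T R) (xi : nat -> {RV P >-> R}) : Prop :=
  forall (J : seq nat) (A : nat -> set R), uniq J ->
    (forall i, measurable (A i)) ->
    (P (\bigcap_(i in [set` J]) (xi i @^-1` A i)) =
     \prod_(i <- J) P (xi i @^-1` A i))%E.

(* Equality of laws is required on Borel sets only: outside the sigma-algebra
   the values of a measure are meaningless. *)
Definition identically_distributed (d : measure_display) (T : measurableType d)
    (R : realType) (P : probability T R) (xi : nat -> {RV P >-> R})
    (F : probability R R) : Prop :=
  forall (i : nat) (B : set R), measurable B -> distribution P (xi i) B = F B.

(* S_n = xi_1 + ... + xi_n; the summands are indexed from 1. *)
Definition partial_sum (d : measure_display) (T : measurableType d)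
    (R : realType) (P : probability T R) (xi : nat -> {RV P >-> R})
    (n : nat) : {RV P >-> R} :=
  \sum_(1 <= i < n.+1) (xi i : {mfun T >-> R}).

Definition tail_conv (d : measure_display) (T : measurableType d)
    (R : realType) (P : probability T R) (xi : nat -> {RV P >-> R})
    (n : nat) (x : R) : R :=
  tail (distribution P (partial_sum xi n)) x.

(* Main.v *)
Require Import Defs.
From HB Require Import structures.
From mathcomp Require Import all_boot all_order all_algebra.
From mathcomp Require Import all_classical all_reals all_analysis.
From mathcomp Require Import measurable_realfun.
From mathcomp Require Import ring lra.
Set Implicit Arguments.
Unset Strict Implicit.
Unset Printing Implicit Defensive.
Import Order.TTheory GRing.Theory Num.Theory.
Import numFieldNormedType.Exports.
Local Open Scope classical_set_scope.
Local Open Scope ring_scope.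

(** Write T for the tail of F, xi for a variable with law F and S n for the
    n-th partial sum.  A sum of heavy-tailed variables is large essentially
    because one of the summands is, so with negative drift P(S n > x) should
    be of the order of the sum over k < n of T(x + k b) for some b > 0.  This
    heuristic becomes a proof through a supersolution of the recursion
      P(S (n+1) > x) = E P(S n > x - xi),
    which is [partial_sum_tail_rec].

    Fix c >= 0 above the mean of F and recentre: w_n(x) = P(S n > x + c n)
    satisfies w_(n+1)(x) = E w_n(x + c - xi).  With Q the primitive of T
    ([itail]), the continuous analogue of the sum above is
      window h z = Q(z + h) - Q(z) = int_z^(z+h) T.
    The claim is that, for a small delta > 0, a large level x0 and a large C,
      w_n(x) <= C window (n delta) x   for all n and all x >= x0.
    Since window h z <= h T(z), this gives P(S n > x + c n) <= K n T(x)
    ([tail_conv_drift]).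

    The induction step ([expectation_step]) bounds E w_n(x + c - xi) by
    splitting according to the recentred jump y = xi - c.
    - If y > x - x0, bound w_n by 1; the contribution is at most T(x - x0),
      hence at most L T(x).
    - If |y| <= A, then window (n delta) varies almost linearly, and the
      change from x + delta to x - y is proportional to y + delta up to an
      error small compared with T(x).  The truncated mean of y + delta is
      at most 0, which is where the drift enters.
    - If y < -A, the window only decreases.
    - If A < y <= x - x0, Fubini turns the expectation of the increment of Q
      into the integral of T(x - u) T(u) over [A, x - A], up to a term of
      order A T(A) T(x) ([integral_mid_le]).
    Passing from n to n + 1 gains the integral of T over [x, x + delta], which
    is about delta T(x) and pays for all of this.

    The class S* supplies what the step needs.  Splitting the convolution
    integral over [0, x] at A, x/2 and x - A, and bounding T below by
    monotonicity on suitable pieces, shows both that T(x - A) / T(x) tends to 1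
    ([Sstar_long_tailed]) and that the part over [A, x - A] is, for large A and
    then large x, at most any given fraction of T(x) ([Sstar_mid_small]).

    A negative mean allows c = 0, and the bound is K n T(x).  For a
    nonnegative mean, take c' strictly between the mean and c, so that
    P(S n > x) <= K n T(x - c' n).  For x > c n, the integrand T(x - y) T(y) is
    at least T(x - c' n) T(c n) on the interval [c' n, c n] of length
    (c - c') n; the convolution integral being at most B T(x), the factor n is
    absorbed and n T(x - c' n) T(c n) <= B T(x) / (c - c').  For x <= c n the
    bound is trivial. *)

(** * Tails, their primitive and their convolution integral *)

Section tail.
Context {R : realType}.
Variable F : probability R R.
Local Notation mu := (@lebesgue_measure R).
Local Notation T := (tail F).

Lemma EFin_tail (x : R) : (T x)%:E = F `]x, +oo[%classic.
Proof. by rewrite /tail fineK// fin_num_measure. Qed.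

Lemma tail_ge0 (x : R) : 0 <= T x.
Proof. by rewrite -lee_fin EFin_tail. Qed.

Lemma tail_le1 (x : R) : T x <= 1.
Proof. by rewrite -lee_fin EFin_tail probability_le1. Qed.

Lemma tail_nincr (x y : R) : x <= y -> T y <= T x.
Proof.
move=> xy; rewrite -lee_fin !EFin_tail le_measure ?inE//.
exact: subitvPl.
Qed.

Lemma measurable_tail : measurable_fun setT T.
Proof. by apply: nonincreasing_measurable => // x y; exact: tail_nincr. Qed.

Lemma integrable_bounded_itv (f : R -> R) (a b : R) (c d : bool) (M : R) :
  measurable_fun setT f -> (forall x, `|f x| <= M) ->
  mu.-integrable [set` Interval (BSide c a) (BSide d b)] (EFin \o f).
Proof.
move=> mf f1; apply: measurable_bounded_integrable => //=.
- rewrite lebesgue_measure_itv/=; case: ifPn => // _; by rewrite -EFinB ltry.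
- exact: measurable_funTS.
- exists M; split; first exact: num_real.
  by move=> y My x _ /=; rewrite (le_trans (f1 x))// ltW.
Qed.

Lemma integrable_tail_itv (a b : R) (c d : bool) :
  mu.-integrable [set` Interval (BSide c a) (BSide d b)] (EFin \o T).
Proof.
apply: (@integrable_bounded_itv _ _ _ _ _ 1); first exact: measurable_tail.
by move=> x; rewrite ger0_norm ?tail_ge0 ?tail_le1.
Qed.

Definition itail (z : R) : R := \int[mu]_(u in `]0, z]) T u.

Lemma itailB (z w : R) : 0 <= z -> z <= w ->
  itail w - itail z = \int[mu]_(u in `]z, w]) T u.
Proof.
move=> z0 zw; rewrite /itail Rintegral_itvB ?bnd_simp//.
exact: integrable_tail_itv.
Qed.

Lemma Rintegral_itv_cst (z w k : R) : z <= w ->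
  \int[mu]_(u in `]z, w]) k = k * (w - z).
Proof.
move=> zw; rewrite Rintegral_cst//= lebesgue_measure_itv/= lte_fin.
move: zw; rewrite le_eqVlt => /predU1P[->|->//]; by rewrite ltxx subrr.
Qed.

Lemma integrable_cst_itv (a b k : R) (c d : bool) :
  mu.-integrable [set` Interval (BSide c a) (BSide d b)] (EFin \o (fun=> k)).
Proof. by apply: (@integrable_bounded_itv _ _ _ _ _ `|k|). Qed.

Lemma itail_ge (z w : R) : 0 <= z -> z <= w ->
  (w - z) * T w <= itail w - itail z.
Proof.
move=> z0 zw; rewrite itailB// mulrC -Rintegral_itv_cst//.
apply: le_Rintegral => //.
- exact: integrable_cst_itv.
- exact: integrable_tail_itv.
- by move=> u /=; rewrite in_itv/= => /andP[_ uw]; exact: tail_nincr.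
Qed.

Lemma itail_le (z w : R) : 0 <= z -> z <= w ->
  itail w - itail z <= (w - z) * T z.
Proof.
move=> z0 zw; rewrite itailB// mulrC -Rintegral_itv_cst//.
apply: le_Rintegral => //.
- exact: integrable_tail_itv.
- exact: integrable_cst_itv.
- by move=> u /=; rewrite in_itv/= => /andP[/ltW zu _]; exact: tail_nincr.
Qed.

Lemma itail_nondecreasing : nondecreasing_fun itail.
Proof.
move=> z w zw; have [z0|z0] := leP 0 z.
  rewrite -subr_ge0 (le_trans _ (itail_ge z0 zw))//.
  by rewrite mulr_ge0 ?subr_ge0 ?tail_ge0.
rewrite {1}/itail set_itv_ge ?Rintegral_set0; last by rewrite bnd_simp -leNgt ltW.
by apply: Rintegral_ge0 => u _; exact: tail_ge0.
Qed.

Lemma measurable_itail : measurable_fun setT itail.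
Proof. exact: nondecreasing_measurable itail_nondecreasing. Qed.

(** The two endpoints trade sides under reflection, and half-open intervals
    stay of the same length, which determines Lebesgue measure. *)
Lemma lebesgue_measure_reflect (x : R) (A : set R) : measurable A ->
  pushforward mu ((fun y => x - y) : _ -> measurableTypeR R) A = mu A.
Proof.
move=> mA.
have mf : measurable_fun setT ((fun y => x - y) : measurableTypeR R -> measurableTypeR R).
  exact: measurable_funB.
apply/esym/(lebesgue_measure_unique (mu := pushforward mu
  ((fun y => x - y) : measurableTypeR R -> measurableTypeR R))) =>
  //= _ [[a b]] _ <-.
rewrite /pushforward/=.
rewrite (_ : _ @^-1` _ = `[x - b, x - a[%classic); last first.
  by apply/seteqP; split=> y/=; rewrite !in_itv/=; lra.
rewrite !lebesgue_measure_itv/= !lte_fin ltrD2l ltrN2.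
by case: ifPn => // _; rewrite -!EFinB; congr _%:E; lra.
Qed.

Definition tailcv (x y : R) := T (x - y) * T y.

Lemma measurable_tailcv x : measurable_fun setT (tailcv x).
Proof.
apply: measurable_funM; last exact: measurable_tail.
apply: measurableT_comp; first exact: measurable_tail.
exact: measurable_funB.
Qed.

Lemma tailcv_ge0 x y : 0 <= tailcv x y.
Proof. by rewrite mulr_ge0 ?tail_ge0. Qed.

Lemma tailcv_le1 x y : tailcv x y <= 1.
Proof. by rewrite mulr_ile1 ?tail_ge0 ?tail_le1. Qed.

Lemma integrable_tailcv x a b c d :
  mu.-integrable [set` Interval (BSide c a) (BSide d b)] (EFin \o (tailcv x)).
Proof.
apply: (@integrable_bounded_itv _ _ _ _ _ 1); first exact: measurable_tailcv.
by move=> y; rewrite ger0_norm ?tailcv_ge0 ?tailcv_le1.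
Qed.

Lemma Rintegral_tail_reflect (x a b : R) : a <= b -> b <= x ->
  \int[mu]_(y in `]a, b]) T (x - y) = itail (x - a) - itail (x - b).
Proof.
move=> ab bx; rewrite itailB ?subr_ge0 ?lerD2l ?lerN2//.
rewrite [RHS]Rintegral_itv_obnd_cbnd; last exact: integrable_tail_itv.
rewrite -[RHS]Rintegral_itv_bndo_bndc; last exact: integrable_tail_itv.
have mf : measurable_fun setT
    ((fun y => x - y) : measurableTypeR R -> measurableTypeR R).
  exact: measurable_funB.
rewrite /Rintegral (_ : [set` `]a, b]] =
    ((fun y => x - y) : measurableTypeR R -> measurableTypeR R) @^-1`
      [set` `[x - b, x - a[]); last first.
  by apply/seteqP; split=> y/=; rewrite !in_itv/=; lra.
congr fine.
rewrite -(ge0_integral_pushforward mf mu (f := fun y => (T y)%:E))//.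
- by apply: eq_measure_integral => A mA _; exact: lebesgue_measure_reflect.
- apply/measurable_EFinP; apply: measurable_funTS; exact: measurable_tail.
- by move=> y _; rewrite lee_fin tail_ge0.
Qed.

(** The integral in the definition of S* is [itailcv 0 x x]; see [itailcvE]. *)
Definition itailcv (a b x : R) := \int[mu]_(y in `]a, b]) tailcv x y.

Lemma itailcvE x :
  \int[mu]_(y in `[0, x]) (T (x - y) * T y) = itailcv 0 x x.
Proof.
by rewrite /itailcv Rintegral_itv_obnd_cbnd//; exact: integrable_tailcv.
Qed.

Lemma itailcv_split a b c x : a <= b -> b <= c ->
  itailcv a c x = itailcv a b x + itailcv b c x.
Proof.
move=> ab bc; rewrite -[itailcv b c x](Rintegral_itvB (a := BRight a))//.
- by rewrite addrC subrK.
- exact: integrable_tailcv.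
Qed.

Lemma itailcv_ge0 a b x : 0 <= itailcv a b x.
Proof. by apply: Rintegral_ge0 => y _; exact: tailcv_ge0. Qed.

Lemma itailcv_le a b x : a <= b -> itailcv a b x <= b - a.
Proof.
move=> ab; rewrite -[leRHS]mul1r -Rintegral_itv_cst//.
apply: le_Rintegral => //.
- exact: integrable_tailcv.
- exact: integrable_cst_itv.
- by move=> y _; exact: tailcv_le1.
Qed.

(** On ]a, b] the factor T(x - y) is smallest at y = a. *)
Lemma itailcv_gel a b x : 0 <= a -> a <= b ->
  T (x - a) * (itail b - itail a) <= itailcv a b x.
Proof.
move=> a0 ab; rewrite itailB// -RintegralZl//; last exact: integrable_tail_itv.
apply: le_Rintegral => //.
- apply: (integrable_bounded_itv _ _ _ _ (M := 1)).
    by apply: measurable_funM => //; exact: measurable_tail.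
  by move=> y; rewrite ger0_norm ?mulr_ge0 ?mulr_ile1 ?tail_ge0 ?tail_le1.
- exact: integrable_tailcv.
- move=> y /=; rewrite in_itv/= => /andP[ay _].
  by rewrite ler_wpM2r ?tail_ge0// tail_nincr//; lra.
Qed.

(** The mirror image of [itailcv_gel]: freeze the factor T(y) at y = b. *)
Lemma itailcv_ger a b x : a <= b -> b <= x ->
  T b * (itail (x - a) - itail (x - b)) <= itailcv a b x.
Proof.
move=> ab bx.
have mT : measurable_fun setT (fun y : R => T (x - y)).
  apply: measurableT_comp; first exact: measurable_tail.
  exact: measurable_funB.
rewrite -Rintegral_tail_reflect// -RintegralZl//; last first.
  apply: (integrable_bounded_itv _ _ _ _ (M := 1)) => // y.
  by rewrite ger0_norm ?tail_ge0 ?tail_le1.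
apply: le_Rintegral => //.
- apply: (integrable_bounded_itv _ _ _ _ (M := 1)).
    exact: measurable_funM.
  by move=> y; rewrite ger0_norm ?mulr_ge0 ?mulr_ile1 ?tail_ge0 ?tail_le1.
- exact: integrable_tailcv.
- move=> y /=; rewrite in_itv/= => /andP[_ yb].
  by rewrite mulrC ler_wpM2l ?tail_ge0// tail_nincr.
Qed.

Lemma itailcv_ge_mul a b x : a <= b ->
  (b - a) * (T (x - a) * T b) <= itailcv a b x.
Proof.
move=> ab; rewrite mulrC -Rintegral_itv_cst//.
apply: le_Rintegral => //.
- exact: integrable_cst_itv.
- exact: integrable_tailcv.
- move=> y /=; rewrite in_itv/= => /andP[ay yb].
  by rewrite ler_pM ?tail_ge0// tail_nincr//; lra.
Qed.

Lemma itail0 : itail 0 = 0.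
Proof. by rewrite /itail set_itvoc0 Rintegral_set0. Qed.

(** Each of the end pieces [0, A] and [x - A, x] contributes at least
    T(x) Q(A): freeze the factor whose argument is near x. *)
Lemma itailcv_mid A x : 0 <= A -> 2 * A <= x ->
  itailcv A (x - A) x <= itailcv 0 x x - 2 * itail A * T x.
Proof.
move=> A0 Ax.
rewrite (@itailcv_split 0 A x); [|lra|lra].
rewrite (@itailcv_split A (x - A) x); [|lra|lra].
have := itailcv_gel x (lexx 0) A0.
have := @itailcv_ger (x - A) x x.
rewrite itail0 !subr0 subrr itail0 subr0 (_ : x - (x - A) = A); last by lra.
have h : x - A <= x by lra.
move=> /(_ h (lexx x)); lra.
Qed.

(** The lower bound behind long-tailedness: compared with T(x) Q(x/2), the
    pieces [A, x/2] and [x/2, x - A] carry the larger factor T(x - A). *)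
Lemma itailcv_ge4 A x : 0 <= A -> 2 * A <= x ->
  2 * (T x * itail A + T (x - A) * (itail (x / 2) - itail A)) <=
  itailcv 0 x x.
Proof.
move=> A0 Ax.
have := itailcv_mid A0 Ax.
rewrite (@itailcv_split A (x / 2) (x - A)); [|lra|lra].
have h : A <= x / 2 by lra.
have := itailcv_gel x A0 h.
have h1 : x / 2 <= x - A by lra.
have h2 : x - A <= x by lra.
have := itailcv_ger h1 h2.
have -> : x - x / 2 = x / 2 by lra.
have -> : x - (x - A) = A by lra.
by lra.
Qed.

End tail.

(** * Consequences of membership in S* *)

Section Sstar.
Context {R : realType}.
Variable F : probability R R.
Hypothesis FS : Sstar F.
Local Notation mu := (@lebesgue_measure R).
Local Notation T := (tail F).
Local Notation Q := (itail F).
Local Notation J x := (itailcv F 0 x x).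

Lemma Sstar_tail_gt0 x : 0 < T x.
Proof. by have [_ + _] := FS; apply. Qed.

(** The expectation of the positive part of a variable with law F. *)
Definition tail_mass : R := \int[mu]_(y in `[0, +oo[) T y.
Local Notation a := tail_mass.

Lemma Sstar_ratio (e : R) : 0 < e ->
  exists X, forall x, X <= x -> `|1 - J x / (2 * a * T x)| <= e.
Proof.
move=> e0; have [_ _ /=] := FS.
move/cvgrPdist_le => /(_ _ e0) [X [_ XP]].
exists (X + 1) => x Xx.
have Xx' : X < x by lra.
by have := XP _ Xx'; rewrite itailcvE.
Qed.

(** Division by 0 yields 0, and an infinite integral also reads 0 as a real
    number; both degenerate cases would make the ratio in S* vanish
    identically instead of tending to 1.  Finiteness of the integral thus comes
    from here as well ([EFin_tail_mass]). *)
Lemma tail_mass_gt0 : 0 < a.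
Proof.
rewrite lt_neqAle Rintegral_ge0 ?andbT; last by move=> y _; exact: tail_ge0.
apply/eqP => a0.
have h : 0 < (1 / 2 : R) by lra.
have [X /(_ X (lexx X))] := Sstar_ratio h.
by rewrite -a0 mulr0 mul0r invr0 mulr0 subr0 normr1; lra.
Qed.

Lemma EFin_tail_mass : (a%:E = \int[mu]_(y in `[0%R, +oo[) (T y)%:E)%E.
Proof.
have := tail_mass_gt0; rewrite /tail_mass /Rintegral.
case: (\int[mu]_(y in _) _)%E => //=; by rewrite ltxx.
Qed.

Lemma EFin_itail x : ((Q x)%:E = \int[mu]_(y in `[0%R, x]) (T y)%:E)%E.
Proof.
rewrite /itail Rintegral_itv_obnd_cbnd; last exact: integrable_tail_itv.
rewrite /Rintegral fineK//; apply: integrable_fin_num => //.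
exact: integrable_tail_itv.
Qed.

Lemma itail_le_tail_mass x : Q x <= a.
Proof.
rewrite -lee_fin EFin_tail_mass EFin_itail.
apply: ge0_subset_integral => //=.
- apply/measurable_EFinP; apply: measurable_funTS; exact: measurable_tail.
- by move=> y _; rewrite lee_fin tail_ge0.
- exact: subset_itvl.
Qed.

Lemma itail_near_tail_mass e : 0 < e ->
  exists2 X, 0 <= X & forall x, X <= x -> a - e < Q x.
Proof.
move=> e0.
have := EFin_tail_mass; rewrite ge0_integral_ereal_sup; last 2 first.
- by move=> y; exact: tail_ge0.
- exact: measurable_tail.
set S := (X in ereal_sup X) => Sa.
have : (ereal_sup S \is a fin_num)%E by rewrite -Sa.
move=> /ub_ereal_sup_adherent => /(_ _ e0) [_ [n _ <-]].
rewrite -Sa -EFinD -EFin_itail lte_fin => h.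
exists n.+1%:R => // x nx; rewrite (lt_le_trans h)// itail_nondecreasing//.
Qed.

Lemma itail_lt_tail_mass x : 0 <= x -> Q x < a.
Proof.
move=> x0; apply: lt_le_trans (itail_le_tail_mass (x + 1)).
rewrite -subr_gt0; apply: lt_le_trans (itail_ge F x0 _); last by lra.
by rewrite mulr_gt0 ?Sstar_tail_gt0//; lra.
Qed.

Lemma itailcv_upper e : 0 < e ->
  exists X, forall x, X <= x -> J x <= (2 * a + e) * T x.
Proof.
move=> e0; have a0 := tail_mass_gt0.
have h : 0 < e / (2 * a) by rewrite divr_gt0//; lra.
have [X XP] := Sstar_ratio h.
exists X => x /XP; rewrite ler_distlC => /andP[_].
rewrite ler_pdivrMr ?mulr_gt0 ?Sstar_tail_gt0//.
move=> /le_trans; apply.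
rewrite le_eqVlt; apply/orP; left; apply/eqP; field.
by lra.
Qed.

(** Write k = a - Q(A).  By [itailcv_ge4] the convolution integral is at least
    2 T(x) Q(A) + 2 T(x - A) (k - e'), and by S* it is at most
    (2 a + 2 e') T(x); hence T(x - A) (k - e') <= T(x) (k + e'). *)
Lemma Sstar_long_tailed A e : 0 <= A -> 0 < e ->
  exists X, forall x, X <= x -> T (x - A) <= (1 + e) * T x.
Proof.
move=> A0 e0.
have k0 : 0 < a - Q A by rewrite subr_gt0 itail_lt_tail_mass.
set k := a - Q A in k0.
(* chosen so that (k + e') = (1 + e) (k - e') *)
pose e' := k * e / (2 + e).
have e'0 : 0 < e' by rewrite divr_gt0 ?mulr_gt0//; lra.
have e'k : e' * (2 + e) = k * e by rewrite /e' mulfVK//; lra.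
have h2 : 0 < 2 * e' by lra.
have [X1 X1P] := itailcv_upper h2.
have [X2 X20 X2P] := itail_near_tail_mass e'0.
exists (Num.max X1 (Num.max (2 * X2) (2 * A))) => x.
rewrite !ge_max => /andP[/X1P h1 /andP[xX2 xA]].
have h3 : X2 <= x / 2 by lra.
have {}h3 := X2P _ h3.
have := itailcv_ge4 F A0 xA => h4.
have Tx := Sstar_tail_gt0 x.
have Ty := Sstar_tail_gt0 (x - A).
have h5 : T (x - A) * (k - e') <= (k + e') * T x.
  have : T (x - A) * (k - e') <= T (x - A) * (Q (x / 2) - Q A).
    by rewrite ler_wpM2l ?tail_ge0//; rewrite /k; lra.
  have : (2 * a + 2 * e') * T x = 2 * (T x * Q A + (k + e') * T x).
    by rewrite /k; ring.
  by lra.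
have ke : 0 < k - e'.
  have : (k - e') * (2 + e) = 2 * k by rewrite mulrBl e'k; ring.
  by move=> h; rewrite -(pmulr_lgt0 (x := 2 + e))//; lra.
rewrite -(ler_pM2r ke) (le_trans h5)// -mulrA (mulrC (T x)) mulrA.
rewrite ler_wpM2r ?tail_ge0//.
by have : e' * (2 + e) = k * e by []; lra.
Qed.

(** By S* and [itailcv_mid] the middle piece is at most about
    2 (a - Q(A)) T(x). *)
Lemma Sstar_mid_small e : 0 < e ->
  exists2 A0, 0 <= A0 & forall A, A0 <= A ->
  exists X, forall x, X <= x -> itailcv F A (x - A) x <= e * T x.
Proof.
move=> e0; have e2 : 0 < e / 4 by lra.
have [A0 A00 A0P] := itail_near_tail_mass e2.
exists A0 => // A /[dup] AA /A0P QA.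
have e3 : 0 < e / 2 by lra.
have [X XP] := itailcv_upper e3.
exists (Num.max X (2 * A)) => x; rewrite ge_max => /andP[/XP JX Ax].
have := itailcv_mid F (le_trans A00 AA) Ax.
have Tx := Sstar_tail_gt0 x.
have : T x * (2 * a + e / 2 - 2 * Q A) <= T x * e.
  by rewrite ler_pM2l//; lra.
by lra.
Qed.

(** The mass of T on [A/2, A] is at least (A/2) T(A), and it vanishes for
    large A. *)
Lemma Sstar_mulr_tail_small e : 0 < e ->
  exists2 A0, 0 <= A0 & forall A, A0 <= A -> A * T A <= e.
Proof.
move=> e0; have e2 : 0 < e / 2 by lra.
have [X X0 XP] := itail_near_tail_mass e2.
exists (2 * X); first lra.
move=> A XA.
have A2 : X <= A / 2 by lra.
have := XP _ A2; have := itail_le_tail_mass A.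
have h0 : 0 <= A / 2 by lra.
have h1 : A / 2 <= A by lra.
by have := itail_ge F h0 h1; lra.
Qed.

Lemma Sstar_itailcv_bounded :
  exists2 B, 0 < B & forall x, 0 <= x -> J x <= B * T x.
Proof.
have [X XP] := itailcv_upper ltr01.
pose X' := Num.max X 1.
exists (Num.max (2 * a + 1) (X' / T X')).
  by rewrite lt_max; apply/orP; left; have := tail_mass_gt0; lra.
move=> x x0; have [Xx|xX] := leP X x.
  apply: le_trans (XP _ Xx) _; rewrite ler_wpM2r ?tail_ge0//.
  by rewrite le_max lexx.
have xX' : x <= X' by rewrite /X' le_max (ltW xX).
apply: (@le_trans _ _ (X' / T X' * T x)).
  rewrite (le_trans (itailcv_le F x x0))// subr0 mulrAC ler_pdivlMr ?Sstar_tail_gt0//.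
  by rewrite ler_pM ?tail_ge0 ?tail_nincr.
by rewrite ler_wpM2r ?tail_ge0// le_max lexx orbT.
Qed.

End Sstar.

(** * Jumps of intermediate size *)

Section mid.
Context {R : realType}.
Variable F : probability R R.
Local Notation mu := (@lebesgue_measure R).
Local Notation T := (tail F).
Local Notation Q := (itail F).

Lemma EFin_itailB (z w : R) : 0 <= z -> z <= w ->
  ((Q w - Q z)%:E = \int[mu]_(u in `]z, w]) (T u)%:E)%E.
Proof.
move=> z0 zw; rewrite itailB// /Rintegral fineK//.
apply: integrable_fin_num => //; exact: integrable_tail_itv.
Qed.

Variables (c A x0 x delta : R).
(* For y in D the increment of Q from x + c - y to x + delta is the integral over
   u of the kernel phi (y, u).  The lower end x0 of E follows from the other two
   factors; stating it keeps u away from 0 once the order is exchanged. *)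
Let D : set R := `]c + A, c + (x - x0)]%classic.
Let E : set R := `]x0, x + delta]%classic.
Let phi (z : R * R) : R :=
  \1_D z.1 * \1_E z.2 * \1_(`]0, +oo[%classic : set R) (z.1 + z.2 - x - c) * T z.2.

Let phi_ge0 z : 0 <= phi z.
Proof. by rewrite !mulr_ge0 ?tail_ge0. Qed.

Let measurable_phi : measurable_fun setT phi.
Proof.
apply: measurable_funM; last exact: measurableT_comp (measurable_tail F) measurable_snd.
apply: measurable_funM.
  apply: measurable_funM.
    have mD : measurable D by exact: measurable_itv.
    apply: (measurableT_comp (f := \1_D : R -> R)); last exact: measurable_fst.
    exact: measurable_indic.
  have mE : measurable E by exact: measurable_itv.
  apply: (measurableT_comp (f := \1_E : R -> R)); last exact: measurable_snd.
  exact: measurable_indic.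
have mP : measurable (`]0, +oo[%classic : set R) by exact: measurable_itv.
apply: (measurableT_comp (f := \1_(`]0, +oo[%classic : set R) : R -> R)).
  exact: measurable_indic.
apply: measurable_funB => //; apply: measurable_funB => //.
exact: measurable_funD.
Qed.

Let phi_u (y : R) : 0 <= c -> 0 <= A -> A <= x0 -> 0 < delta -> x0 <= x ->
  (\int[mu]_u (phi (y, u))%:E =
   ((fun y => (Q (x + delta) - Q (x + c - y))%:E) \_ D) y)%E.
Proof.
move=> c0 A0 Ax0 d0 x0x; rewrite patchE; case: ifPn => yD; last first.
  by apply: integral0_eq => u _; rewrite /phi indicE/= (negbTE yD) !mul0r.
have [y1 y2] : c + A < y /\ y <= c + (x - x0).
  by move: yD; rewrite inE /D/= in_itv/= => /andP.
rewrite EFin_itailB; [|lra|lra].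
rewrite [RHS]integral_mkcond; apply: eq_integral => u _.
rewrite /phi/= indicE yD mul1r patchE.
have uE : (u \in E) = (x0 < u <= x + delta).
  by apply/idP/idP; rewrite inE /E/= in_itv/=.
have uP : (y + u - x - c \in (`]0, +oo[%classic : set R)) = (x + c - y < u).
  by apply/idP/idP; rewrite inE/= in_itv/= andbT; lra.
have uI : (u \in (`]x + c - y, x + delta]%classic : set R)) = (x + c - y < u <= x + delta).
  by apply/idP/idP; rewrite inE/= in_itv/=.
rewrite !indicE uE uP uI.
case: ifPn => [u1|u1].
  have -> : x0 < u <= x + delta by lra.
  have -> : x + c - y < u by lra.
  by rewrite !mul1r.
have [u2|u2] := boolP (x + c - y < u); last by rewrite mulr0 mul0r.
have -> : (x0 < u <= x + delta) = false.
  by apply/negbTE/negP => u3; move: u1; rewrite u2; lra.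
by rewrite !mul0r.
Qed.

(* For fixed u, the kernel requires y > c + x - u and y > c + A; since c >= 0 the
   probability of this is at most T (max (x - u) A). *)
Let phi_y (u : R) : 0 <= c ->
  (\int[F]_y (phi (y, u))%:E <=
   ((fun u => (T u * T (Num.max (x - u) A))%:E) \_ E) u)%E.
Proof.
move=> c0; rewrite patchE; case: ifPn => uE; last first.
  rewrite integral0_eq// => y _.
  by rewrite /phi/= [X in _ * X * _ * _]indicE (negbTE uE) mulr0 !mul0r.
rewrite EFinM (EFin_tail F (Num.max _ _)) -[X in F X]setIT -integral_indic//.
rewrite -ge0_integralZl//; last 2 first.
- exact/measurable_EFinP/measurable_indic.
- by rewrite lee_fin tail_ge0.
apply: ge0_le_integral => //.
- by move=> y _; rewrite lee_fin.
- by apply/measurable_EFinP; apply: measurableT_comp => //; exact: measurable_pair2.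
- by apply/measurable_EFinP; apply: measurable_funM => //; exact: measurable_indic.
- move=> y _; rewrite -EFinM lee_fin /phi/= mulrC ler_wpM2l ?tail_ge0//.
  rewrite !indicE uE mulr1.
  have [yD|yD] := boolP (y \in D); last by rewrite mul0r.
  have [yu|yu] := boolP (y + u - x - c \in (`]0, +oo[%classic : set R)); last by rewrite mulr0.
  rewrite mulr1 ler1n lt0b; move: yD yu; rewrite !inE /D/= !in_itv/= !andbT => /andP[h1 h2] h3.
  by rewrite gt_max; apply/andP; split; lra.
Qed.

(** Tonelli: for u <= x - A the probability bound T(x - u) recreates the
    convolution integrand, and the strip x - A < u <= x + delta of width
    A + delta contributes the first summand. *)
Lemma integral_mid_le :
  0 <= c -> 0 <= A -> A <= x0 -> 0 < delta -> x0 <= x ->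
  (\int[F]_(y in `](c + A)%R, (c + (x - x0))%R]) (Q (x + delta) - Q (x + c - y))%:E <=
   ((A + delta) * T (x - A) * T A + itailcv F A (x - A) x)%:E)%E.
Proof.
move=> c0 A0 Ax0 d0 x0x; have [xA|Ax] := ltP (x - x0) A.
  rewrite set_itv_ge ?integral_set0; last by rewrite bnd_simp -leNgt; lra.
  by rewrite lee_fin addr_ge0 ?itailcv_ge0// !mulr_ge0 ?tail_ge0//; lra.
rewrite integral_mkcond -(eq_integral _ _ (fun y _ => phi_u y c0 A0 Ax0 d0 x0x)).
rewrite (fubini_tonelli (m1 := F) (m2 := mu) (EFin \o phi)); last 2 first.
- exact/measurable_EFinP.
- by move=> z; rewrite lee_fin.
have mk : measurable_fun setT (fun u => T u * T (Num.max (x - u) A)).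
  apply: measurable_funM; first exact: measurable_tail.
  apply: measurableT_comp; first exact: measurable_tail.
  by apply: measurable_maxr => //; exact: measurable_funB.
apply: (@le_trans _ _ (\int[mu]_(u in E) (T u * T (Num.max (x - u) A))%:E)%E).
  rewrite [leRHS]integral_mkcond; apply: ge0_le_integral => //.
  - by move=> u _; apply: integral_ge0 => y _; rewrite lee_fin.
  - apply: (measurable_fun_fubini_tonelli_G (m1 := F) (EFin \o phi)).
      exact/measurable_EFinP.
    by move=> z; rewrite lee_fin.
  - apply/(measurable_restrictT _ _).1; first exact: measurable_itv.
    exact/measurable_EFinP/measurable_funTS.
  - by move=> u _; exact: phi_y.
have Ik a b : mu.-integrable `]a, b] (EFin \o (fun u => T u * T (Num.max (x - u) A))).
  apply: (integrable_bounded_itv _ _ _ _ (M := 1)) => // u.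
  by rewrite ger0_norm ?mulr_ge0 ?mulr_ile1 ?tail_ge0 ?tail_le1.
rewrite -[leLHS]fineK; last exact: integrable_fin_num (Ik _ _).
rewrite lee_fin -/(Rintegral _ _ _).
(* split the integral over u at x - A *)
rewrite /E -[leLHS](subrK (\int[mu]_(u in `]x0, x - A]) (T u * T (Num.max (x - u) A)))).
rewrite Rintegral_itvB ?bnd_simp//; [|lra|lra].
apply: lerD.
  rewrite (_ : (A + delta) * _ * _ = (T (x - A) * T A) * (x + delta - (x - A))); last by ring.
  rewrite -Rintegral_itv_cst; last by lra.
  apply: le_Rintegral => //; first exact: integrable_cst_itv.
  move=> u /=; rewrite in_itv/= => /andP[u1 u2].
  by rewrite ler_pM ?tail_ge0// tail_nincr ?le_max ?lexx ?orbT//; lra.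
rewrite (@itailcv_split _ F A x0 (x - A))//; last by lra.
rewrite -[leLHS]add0r lerD ?itailcv_ge0//.
apply: le_Rintegral => //; first exact: integrable_tailcv.
move=> u /=; rewrite in_itv/= => /andP[u1 u2].
rewrite /tailcv mulrC ler_wpM2r ?tail_ge0// tail_nincr//.
by rewrite le_max lexx.
Qed.

End mid.

(** * The supersolution *)

Section step.
Context {R : realType}.
Variable F : probability R R.
Hypothesis FS : Sstar F.
Local Notation mu := (@lebesgue_measure R).
Local Notation T := (tail F).
Local Notation Q := (itail F).

Definition window (h z : R) : R := Q (z + h) - Q z.

(** Overlapping windows are compared on their symmetric difference; disjoint ones
    through the value of T between them. *)
Lemma window_nincr h z w : 0 <= h -> 0 <= z -> z <= w ->
  window h w <= window h z.
Proof.
move=> h0 z0 zw; rewrite /window; have [wz|/ltW zhw] := leP w (z + h).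
- have := itail_ge F z0 zw.
  have zh0 : 0 <= z + h by lra.
  have zh : z + h <= w + h by lra.
  have := itail_le F zh0 zh.
  have : (w - z) * T (z + h) <= (w - z) * T w.
    by rewrite ler_wpM2l ?tail_nincr//; lra.
  have -> : w + h - (z + h) = w - z by ring.
  by lra.
- have w0 : 0 <= w by lra.
  have wh : w <= w + h by lra.
  have zh : z <= z + h by lra.
  have := itail_le F w0 wh; have := itail_ge F z0 zh.
  have : h * T w <= h * T (z + h) by rewrite ler_wpM2l ?tail_nincr.
  have -> : w + h - w = h by ring.
  have -> : z + h - z = h by ring.
  by lra.
Qed.

(** Moving the window from w to z exchanges the piece of T between z and w for
    its translate by h.  The bound is signed: it holds on both sides of w, with
    the extreme values of T on the two pieces. *)
Lemma windowB_le h z w : 0 <= h -> 0 <= z -> 0 <= w ->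
  window h z - window h w <= (w - z) * (T z - T (w + h)).
Proof.
move=> h0 z0 w0; rewrite /window mulrBr; have [zw|/ltW wz] := leP z w.
- have zh0 : 0 <= z + h by lra.
  have zh : z + h <= w + h by lra.
  have := itail_le F z0 zw; have := itail_ge F zh0 zh.
  have -> : w + h - (z + h) = w - z by ring.
  by lra.
- have zh0 : 0 <= w + h by lra.
  have zh : w + h <= z + h by lra.
  have := itail_ge F w0 wz; have := itail_le F zh0 zh.
  have -> : z + h - (w + h) = z - w by ring.
  by rewrite !mulrBl; lra.
Qed.

(** [windowB_le] with w = x + delta, where T(x + c - y) is replaced by T(x).  The
    remaining coefficient of y - c + delta does not depend on y, so integrating
    over y produces the truncated mean. *)
Lemma windowB_mid h c A delta eps x y :
  0 <= h -> 0 < delta -> delta <= A -> A <= x -> 0 <= eps ->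
  T (x - A) <= (1 + eps) * T x -> (1 - eps) * T x <= T (x + A) ->
  c - A <= y -> y <= c + A ->
  window h (x + c - y) - window h (x + delta) <=
  (y - c + delta) * (T x - T (x + delta + h)) + eps * (A + delta) * T x.
Proof.
move=> h0 d0 dA Ax e0 T1 T2 y1 y2.
have z0 : 0 <= x + c - y by lra.
have w0 : 0 <= x + delta by lra.
have := windowB_le h0 z0 w0.
rewrite (_ : x + delta - (x + c - y) = y - c + delta); last by ring.
move=> /le_trans; apply.
suff : (y - c + delta) * (T (x + c - y) - T x) <= eps * (A + delta) * T x by rewrite !mulrBr; lra.
have Tx := tail_ge0 F x.
have eT : 0 <= eps * T x by rewrite mulr_ge0.
have [s0|s0] := leP 0 (y - c + delta).
- have : (y - c + delta) * (T (x + c - y) - T x) <= (y - c + delta) * (eps * T x).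
    rewrite ler_wpM2l//.
    by have : T (x + c - y) <= T (x - A); [apply: tail_nincr; lra|lra].
  have : (y - c + delta) * (eps * T x) <= (A + delta) * (eps * T x).
    by rewrite ler_wpM2r//; lra.
  by lra.
- have : (c - y - delta) * (T x - T (x + c - y)) <= (c - y - delta) * (eps * T x).
    rewrite ler_wpM2l//; first lra.
    by have : T (x + A) <= T (x + c - y); [apply: tail_nincr; lra|lra].
  have : (c - y - delta) * (eps * T x) <= (A + delta) * (eps * T x).
    by rewrite ler_wpM2r//; lra.
  by lra.
Qed.

Lemma integrable_shift k : F.-integrable setT (EFin \o (fun y => y - k)).
Proof.
have [intF _ _] := FS.
apply: (integrableB measurableT intF (g := EFin \o cst k)).
exact: finite_measure_integrable_cst.
Qed.

Lemma EFin_Rintegral (f : R -> R) D : measurable D -> F.-integrable D (EFin \o f) ->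
  ((\int[F]_(y in D) f y)%:E = \int[F]_(y in D) (f y)%:E)%E.
Proof. by move=> mD fi; rewrite /Rintegral fineK//; exact: integrable_fin_num. Qed.

(** The induction step, with all smallness requirements as hypotheses.  L bounds
    the cost of jumps over the level x0, e1 that of the intermediate jumps, eps
    the error in long-tailedness; the long inequality says that together they
    cost less than the gain C delta T(x) of enlarging the window by delta. *)
Lemma expectation_step (c A x0 delta eps C L e1 h x : R) (w : R -> R) :
  0 <= c -> 0 < delta -> delta <= A -> A <= x0 -> x0 <= x -> 0 <= h -> 0 <= C ->
  0 <= eps ->
  T (x - A) <= (1 + eps) * T x -> (1 - eps) * T x <= T (x + A) ->
  T (x - x0) <= L * T x ->
  \int[F]_(y in `[c - A, c + A]) (y - (c - delta)) <= 0 ->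
  itailcv F A (x - A) x <= e1 * T x ->
  L + C * ((A + delta) * (1 + eps) * T A + e1 + eps * (A + delta)) <=
    C * (delta * (1 - eps)) ->
  measurable_fun setT w -> (forall z, 0 <= w z) -> (forall z, w z <= 1) ->
  (forall z, x0 <= z -> w z <= C * window h z) ->
  (\int[F]_y (w (x + c - y))%:E <= (C * window (delta + h) x)%:E)%E.
Proof.
move=> c0 d0 dA Ax0 x0x h0 C0 e0 T1 T2 TL meanle0 mid const mw w0 w1 wC.
(* jumps across the level x0, intermediate jumps and moderate jumps *)
pose H : set R := `]c + (x - x0), +oo[%classic.
pose M : set R := `]c + A, c + (x - x0)]%classic.
pose B : set R := `[c - A, c + A]%classic.
pose hM := (fun y => Q (x + delta) - Q (x + c - y)) \_ M.
pose hB := (fun y => y - (c - delta)) \_ B.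
pose kap := T x - T (x + delta + h).
pose k := C * window h (x + delta) + C * (eps * (A + delta) * T x).
have Tx0 := tail_ge0 F x.
have win0 z : 0 <= z -> 0 <= window h z.
  by move=> z0; rewrite /window subr_ge0 itail_nondecreasing//; lra.
have kap0 : 0 <= kap by rewrite /kap subr_ge0 tail_nincr//; lra.
have mH : measurable H by exact: measurable_itv.
have mM : measurable M by exact: measurable_itv.
have mB : measurable B by exact: measurable_itv.
have intH : F.-integrable setT (EFin \o \1_H) by exact: integrable_indic.
have intB : F.-integrable setT (EFin \o hB).
  rewrite -restrict_EFin; apply/integrable_restrict => //=; rewrite setTI.
  exact: integrableS (integrable_shift _).
have hM0 y : 0 <= hM y.
  rewrite /hM patchE; case: ifPn => //; rewrite inE /M/= in_itv/= => /andP[y1 y2].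
  by rewrite subr_ge0 itail_nondecreasing//; lra.
have mhM : measurable_fun setT hM.
  have mQ : measurable_fun M (fun y => Q (x + delta) - Q (x + c - y)).
    apply: measurable_funB => //; apply: measurable_funTS.
    apply: measurableT_comp; first exact: measurable_itail.
    exact: measurable_funB.
  exact: (measurable_restrictT _ mM).1 mQ.
have ihM : (\int[F]_y (hM y)%:E <=
   ((A + delta) * T (x - A) * T A + itailcv F A (x - A) x)%:E)%E.
  rewrite (le_trans _ (integral_mid_le F c0 _ Ax0 d0 x0x))//; last lra.
  rewrite le_eqVlt; apply/orP; left; apply/eqP; rewrite [RHS]integral_mkcond.
  by apply: eq_integral => y _; rewrite restrict_EFin.
have intM : F.-integrable setT (EFin \o hM).
  apply/integrableP; split; first exact/measurable_EFinP.
  under eq_integral do rewrite gee0_abs ?lee_fin//.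
  by apply: le_lt_trans ihM _; rewrite ltry.
pose b y := (\1_H y + k) + (C * hM y + C * kap * hB y).
have ik : F.-integrable setT (EFin \o cst k) by exact: finite_measure_integrable_cst.
have intM' : F.-integrable setT (EFin \o (fun y => C * hM y)).
  by apply: integrableZl intM.
have intB' : F.-integrable setT (EFin \o (fun y => C * kap * hB y)).
  by apply: integrableZl intB.
have int1 : F.-integrable setT (EFin \o (fun y => \1_H y + k)).
  exact: integrableD intH ik.
have int2 : F.-integrable setT (EFin \o (fun y => C * hM y + C * kap * hB y)).
  exact: integrableD intM' intB'.
have intb : F.-integrable setT (EFin \o b) by exact: integrableD int1 int2.
(* pointwise bound, one case per size of jump *)
have wb y : w (x + c - y) <= b y.
  have k0 : 0 <= k by rewrite addr_ge0 ?mulr_ge0 ?win0//; lra.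
  rewrite /b indicE.
  have [yH|yH] := boolP (y \in H).
    (* H and B may overlap when x - x0 < A, but hB is nonnegative on H *)
    have yM : y \notin M.
      rewrite notin_setE /M/= in_itv/=; move: yH; rewrite inE /H/= in_itv/=; lra.
    have yB : y \notin B \/ hB y >= 0.
      rewrite /hB patchE; case: ifPn => yB; [right|by left].
      move: yH yB; rewrite !inE /H /B/= !in_itv/=; lra.
    have hB0 : 0 <= hB y by case: yB => // yB; rewrite /hB patchE (negbTE yB).
    have := w1 (x + c - y); have := mulr_ge0 C0 (hM0 y).
    have := mulr_ge0 (mulr_ge0 C0 kap0) hB0; rewrite /=; lra.
  rewrite /= add0r.
  have y1 : y <= c + (x - x0).
    by move: yH; rewrite notin_setE /H/= in_itv/= andbT => /negP; rewrite -leNgt.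
  have z0 : x0 <= x + c - y by lra.
  apply: (le_trans (wC _ z0)).
  have [yM|yM] := leP y (c + A).
    have -> : hM y = 0.
      rewrite /hM patchE memNset//; rewrite /M/= in_itv/=; lra.
    have [yB|yB] := leP (c - A) y.
      have -> : hB y = y - (c - delta).
        by rewrite /hB patchE mem_set//; rewrite /B/= in_itv/= yB.
      have Ax : A <= x by lra.
      have := windowB_mid h0 d0 dA Ax e0 T1 T2 yB yM.
      rewrite -/kap => hh.
      have : C * (window h (x + c - y) - window h (x + delta)) <=
        C * ((y - c + delta) * kap + eps * (A + delta) * T x) by rewrite ler_wpM2l.
      rewrite /k; lra.
    have -> : hB y = 0.
      rewrite /hB patchE memNset//; rewrite /B/= in_itv/=; lra.
    rewrite !mulr0 !addr0 /k.
    have : C * window h (x + c - y) <= C * window h (x + delta).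
      by rewrite ler_wpM2l// window_nincr//; lra.
    have : 0 <= C * (eps * (A + delta) * T x) by rewrite !mulr_ge0//; lra.
    lra.
  have -> : hB y = 0.
    rewrite /hB patchE memNset//; rewrite /B/= in_itv/=; lra.
  have -> : hM y = Q (x + delta) - Q (x + c - y).
    by rewrite /hM patchE mem_set//; rewrite /M/= in_itv/= yM.
  have : 0 <= C * (eps * (A + delta) * T x) by rewrite !mulr_ge0//; lra.
  have : C * (Q (x + c - y + h)) <= C * (Q (x + delta + h)).
    by rewrite ler_wpM2l// itail_nondecreasing//; lra.
  rewrite /k /window; lra.
apply: (@le_trans _ _ (\int[F]_y (b y)%:E)%E).
  apply: ge0_le_integral => //.
  - by move=> y _; rewrite lee_fin.
  - apply/measurable_EFinP; apply: measurableT_comp mw _.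
    exact: measurable_funB.
  - by case/integrableP: intb.
  - by move=> y _; rewrite lee_fin.
rewrite -EFin_Rintegral// lee_fin.
have HE : \int[F]_y \1_H y = T (c + (x - x0)).
  by rewrite /Rintegral integral_indic// setIT.
have -> : \int[F]_y b y = (T (c + (x - x0)) + k) +
    (C * \int[F]_y hM y + C * kap * \int[F]_y hB y).
  rewrite -HE -(RintegralZl C measurableT intM).
  rewrite -(RintegralZl (C * kap) measurableT intB).
  rewrite -(RintegralD measurableT intM' intB').
  rewrite /b (RintegralD measurableT int1 int2).
  rewrite (RintegralD measurableT intH ik) Rintegral_cst//.
  congr (_ + _ + _); rewrite -[RHS]mulr1; congr (_ * _).
  exact: congr1 (probability_setT F).
have hBle : C * kap * \int[F]_y hB y <= 0.
  by rewrite -Rintegral_mkcond mulr_ge0_le0// mulr_ge0.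
have hMle : C * \int[F]_y hM y <=
    C * ((A + delta) * T (x - A) * T A + itailcv F A (x - A) x).
  by rewrite ler_wpM2l// -lee_fin EFin_Rintegral.
have HL : T (c + (x - x0)) <= L * T x.
  by apply: le_trans TL; apply: tail_nincr; lra.
have s1 : (A + delta) * T (x - A) * T A <= (A + delta) * (1 + eps) * T A * T x.
  rewrite (_ : _ * T x = (A + delta) * ((1 + eps) * T x) * T A); last by ring.
  by rewrite ler_wpM2r ?tail_ge0// ler_wpM2l//; lra.
have s2 : C * ((A + delta) * T (x - A) * T A + itailcv F A (x - A) x) <=
  C * ((A + delta) * (1 + eps) * T A * T x + e1 * T x).
  by rewrite ler_wpM2l// lerD.
have s3 := ler_wpM2r Tx0 const.
have s4 : C * (delta * ((1 - eps) * T x)) <= C * (Q (x + delta) - Q x).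
  rewrite ler_wpM2l//.
  have x00 : 0 <= x by lra.
  have xd : x <= x + delta by lra.
  have := itail_ge F x00 xd.
  have -> : x + delta - x = delta by ring.
  apply: le_trans; rewrite ler_wpM2l//; first lra.
  by apply: le_trans T2 _; apply: tail_nincr; lra.
move: s2 s3 s4 hMle hBle HL; rewrite /k /window (addrA x) => s2 s3 s4 hMle hBle HL.
lra.
Qed.

(** By dominated convergence the truncated integrals of y - k tend to the full one,
    which is negative. *)
Lemma truncated_mean_lt0 (c k : R) : \int[F]_y y < k ->
  exists N, forall n, (N <= n)%N ->
    \int[F]_(y in `[c - n%:R, c + n%:R]) (y - k) <= 0.
Proof.
move=> muk; have [intF _ _] := FS.
pose B n : set R := `[c - n%:R, c + n%:R]%classic.
pose f := (fun y : R => y - k).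
have mB n : measurable (B n) by exact: measurable_itv.
have mf : measurable_fun setT f by exact: measurable_funB.
have cvg : ((\int[F]_y ((f \_ (B n)) y)%:E)%E @[n --> \oo] --> (\int[F]_y (f y)%:E)%E).
  apply: (@dominated_cvg _ _ _ F setT measurableT _ _ (fun y => `|f y|%:E)) => //.
  - move=> n; apply/measurable_EFinP.
    exact: (measurable_restrictT _ (mB n)).1 (measurable_funTS mf).
  - move=> y _; apply: cvg_near_cst.
    exists (Num.truncn `|y - c|).+1 => // n /= hn.
    rewrite patchE mem_set//; rewrite /B/= in_itv/=.
    have : `|y - c| <= n%:R.
      by rewrite (le_trans (ltW (Num.Theory.truncnS_gt _)))// ler_nat.
    by rewrite ler_norml; lra.
  - have /integrable_abse := integrable_shift k.
    by apply: eq_integrable.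
  - move=> n y _; rewrite /= lee_fin patchE; case: ifPn => // _.
    by rewrite normr0.
have lt0 : \int[F]_y f y < 0.
  have icst := finite_measure_integrable_cst F k measurableT.
  rewrite (RintegralB measurableT intF icst).
  rewrite Rintegral_cst// (_ : fine _ = 1); first by rewrite mulr1 subr_lt0.
  exact: congr1 (probability_setT F).
rewrite -(EFin_Rintegral measurableT (integrable_shift k)) in cvg.
have [N _ NP] := cvgr_lt _ (fine_cvg cvg) _ lt0.
exists N => n /NP /ltW; apply: le_trans.
by rewrite Rintegral_mkcond.
Qed.

(** The constants are chosen in the order delta, A, eps, x0, L, C: A makes the
    truncated drift negative and the intermediate jumps cheap, eps is small
    compared with delta / A, x0 is where long-tailedness with parameters A and
    eps sets in, and C outweighs the jumps over x0. *)
Lemma supersolution (c : R) : 0 <= c -> \int[F]_y y < c ->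
  exists x0 C delta : R, [/\ 0 <= x0, 0 <= C, 0 < delta &
    forall (n : nat) (x : R) (w : R -> R), x0 <= x ->
      measurable_fun setT w -> (forall z, 0 <= w z) -> (forall z, w z <= 1) ->
      (forall z, x0 <= z -> w z <= C * window (n%:R * delta) z) ->
      (\int[F]_y (w (x + c - y))%:E <=
        (C * window (n.+1%:R * delta) x)%:E)%E].
Proof.
move=> c0 muc; pose delta := (c - \int[F]_y y) / 2.
have d0 : 0 < delta by rewrite /delta; lra.
have muk : \int[F]_y y < c - delta by rewrite /delta; lra.
have [N NP] := truncated_mean_lt0 c muk.
have d16 : 0 < delta / 16 by lra.
have d8 : 0 < delta / 8 by lra.
have [A1 A10 A1P] := Sstar_mulr_tail_small FS d16.
have [A2 A20 A2P] := Sstar_mid_small FS d8.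
have [A [meanA AA1 AA2 Adl]] : exists A : R,
    [/\ \int[F]_(y in `[c - A, c + A]) (y - (c - delta)) <= 0,
        A1 <= A, A2 <= A & delta <= A].
  pose M := Num.max A1 (Num.max A2 delta).
  exists (maxn N (Num.truncn M).+1)%:R.
  have MA : M <= (maxn N (Num.truncn M).+1)%:R.
    by rewrite (le_trans (ltW (Num.Theory.truncnS_gt _)))// ler_nat leq_maxr.
  split; first by apply: NP; exact: leq_maxl.
  - by rewrite (le_trans _ MA)// le_max lexx.
  - by rewrite (le_trans _ MA)// !le_max lexx orbT.
  - by rewrite (le_trans _ MA)// !le_max lexx !orbT.
have A0 : 0 <= A by lra.
have [X1 X1P] := A2P _ AA2.
pose eps := delta / (8 * (A + delta)).
have Ad0 : 0 < 8 * (A + delta) by lra.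
have e0 : 0 < eps by rewrite divr_gt0.
have epsE : eps * (A + delta) = delta / 8 by rewrite /eps; field; lra.
have e16 : eps <= 1 / 16 by rewrite ler_pdivrMr//; lra.
have [X2 X2P] := Sstar_long_tailed FS A0 e0.
pose x0 := Num.max A (Num.max X1 X2).
have x0A : A <= x0 by rewrite le_max lexx.
have x0X1 : X1 <= x0 by rewrite !le_max lexx orbT.
have x0X2 : X2 <= x0 by rewrite !le_max lexx !orbT.
have x00 : 0 <= x0 by lra.
have [X3 X3P] := Sstar_long_tailed FS x00 ltr01.
(* above X3 the ratio T (x - x0) / T x is at most 2, below X3 it is at most
   1 / T X3 *)
pose L := Num.max 2 (T X3)^-1.
have L0 : 0 < L by rewrite lt_max; apply/orP; left; lra.
have LP x : T (x - x0) <= L * T x.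
  have [X3x|xX3] := leP X3 x.
    apply: le_trans (X3P _ X3x) _.
    by rewrite ler_wpM2r ?tail_ge0// /L le_max; apply/orP; left; lra.
  apply: (@le_trans _ _ ((T X3)^-1 * T x)); last first.
    by rewrite ler_wpM2r ?tail_ge0// /L le_max lexx orbT.
  rewrite (le_trans (tail_le1 _ _))// mulrC ler_pdivlMr ?Sstar_tail_gt0//.
  by rewrite mul1r tail_nincr// ltW.
pose C := 4 * L / delta.
have C0 : 0 < C by rewrite !(divr_gt0, mulr_gt0)//; lra.
exists x0, C, delta; split=> //; first exact: ltW.
move=> n x w x0x mw w0 w1 wC.
have Tx := tail_ge0 F x.
rewrite (_ : n.+1%:R * delta = delta + n%:R * delta); last by rewrite -natr1; ring.
apply: (@expectation_step c A x0 delta eps C L (delta / 8)) => //.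
- by rewrite mulr_ge0// ltW.
- exact: ltW.
- exact: ltW.
- by apply: X2P; lra.
- have X2xA : X2 <= x + A by lra.
  have := X2P _ X2xA; rewrite addrK => hx.
  have := tail_ge0 F (x + A) => TA.
  have : (1 - eps) * T x <= (1 - eps) * ((1 + eps) * T (x + A)).
    by rewrite ler_wpM2l//; lra.
  have := mulr_ge0 (mulr_ge0 (ltW e0) (ltW e0)) TA.
  lra.
- by apply: X1P; lra.
- have hA := A1P _ AA1.
  have TA := tail_ge0 F A.
  have h1 : (A + delta) * T A <= delta / 8.
    have : delta * T A <= A * T A by rewrite ler_wpM2r.
    lra.
  have h2 : (A + delta) * (1 + eps) * T A <= (1 + 1 / 16) * (delta / 8).
    rewrite mulrAC mulrC ler_pM//; [lra|rewrite mulr_ge0//; lra|lra].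
  have h3 : delta * (1 - 1 / 16) <= delta * (1 - eps) by rewrite ler_pM2l//; lra.
  rewrite -lerBrDr -mulrBr epsE.
  have : C * (delta / 4) <= C * (delta * (1 - eps) -
     ((A + delta) * (1 + eps) * T A + delta / 8 + delta / 8)).
    by rewrite ler_pM2l//; lra.
  apply: le_trans; rewrite le_eqVlt; apply/orP; left; apply/eqP.
  by rewrite /C; field; lra.
Qed.

End step.

(** * From independence to the recursion for the tails *)

Section independence.
Context d (T : measurableType d) (R : realType) (P : probability T R).

(** The event E and its probability p allow independence from further variables
    to be carried along.  After division by p, the measure
    D |-> P ((X, Y) in D, E) agrees with the product of the laws on rectangles,
    hence everywhere. *)
Lemma pair_law_of_rectangles (X Y : {RV P >-> R}) (E : set T) (p : \bar R) :
  measurable E ->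
  (forall B1 B2, measurable B1 -> measurable B2 ->
    P (X @^-1` B1 `&` (Y @^-1` B2 `&` E)) =
    (P (X @^-1` B1) * (P (Y @^-1` B2) * p))%E) ->
  forall D : set (R * R), measurable D ->
    P ((fun t => (X t, Y t)) @^-1` D `&` E) =
    ((distribution P X \x distribution P Y)%E D * p)%E.
Proof.
move=> mE rect D mD.
pose XY t := (X t, Y t).
have mXY : measurable_fun setT XY by exact: measurable_fun_pair.
have mXYD : measurable (XY @^-1` D) by rewrite -[X in measurable X]setTI; exact: mXY.
have pE : P E = p.
  have := rect setT setT measurableT measurableT.
  by rewrite !preimage_setT !setTI probability_setT !mul1e.
have [p0|p0] := eqVneq p 0%E.
  rewrite p0 mule0; apply/eqP; rewrite eq_le measure_ge0 andbT.
  by rewrite -p0 -pE le_measure ?inE//; exact: measurableI.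
have pfin : p \is a fin_num by rewrite -pE fin_num_measure.
have fp0 : 0 < fine p.
  by rewrite fine_gt0// lt0e p0 -pE measure_ge0/= (le_lt_trans (probability_le1 _ _))// ltry.
have ip0 : 0 <= (fine p)^-1 by rewrite invr_ge0 ltW.
pose m := mscale (NngNum ip0) (pushforward (mrestr P mE) XY).
have mrect A B : measurable A -> measurable B ->
    m mXY (A `*` B) = (distribution P X A * distribution P Y B)%E.
  move=> mA mB; rewrite /m /mscale /= /pushforward /mrestr.
  rewrite (_ : XY @^-1` _ `&` E = X @^-1` A `&` (Y @^-1` B `&` E)); last first.
    by apply/seteqP; split => t /=; rewrite /XY/=; tauto.
  rewrite rect// /distribution /pushforward -[in X in (_ * X)%E = _](fineK pfin).
  rewrite muleCA; congr (_ * _)%E.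
  by rewrite muleCA -EFinM mulVf ?mule1// gt_eqF.
have := product_measure_unique
  (m1 := distribution P X) (m2 := distribution P Y)
  (m' := mscale (NngNum ip0) (pushforward (mrestr P mE) XY)) mrect mD.
rewrite /m /mscale /= /pushforward /mrestr => ->.
have pV : (p * ((fine p)^-1)%:E = 1)%E.
  by rewrite -{1}(fineK pfin) -EFinM mulfV// gt_eqF.
by rewrite muleC muleA pV mul1e.
Qed.

Variable xi : nat -> {RV P >-> R}.

Lemma partial_sum0 t : partial_sum xi 0 t = 0.
Proof. by rewrite /partial_sum big_nil. Qed.

Lemma partial_sumS n t :
  partial_sum xi n.+1 t = partial_sum xi n t + xi n.+1 t.
Proof. by rewrite /partial_sum big_nat_recr. Qed.

Lemma measurable_RV_preimage (X : {RV P >-> R}) (B : set R) :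
  measurable B -> measurable (X @^-1` B).
Proof. by move=> mB; rewrite -[X in measurable X]setTI; exact: measurable_funP. Qed.

Let sumset (B : set R) : set (R * R) := [set z | B (z.1 + z.2)].

Let measurable_sumset B : measurable B -> measurable (sumset B).
Proof.
move=> mB.
have mD : measurable_fun setT (fun z : R * R => z.1 + z.2) by exact: measurable_funD.
by rewrite -[X in measurable X]setTI; exact: mD.
Qed.

Hypothesis xi_indep : mutually_independent xi.

(** Mutual independence concerns the individual variables, so the induction keeps
    an arbitrary block J of later variables: n + 1 is moved from the block into
    the sum, and the rectangles in (S n, xi (n + 1)) are given by the induction
    hypothesis for the block n + 1 :: J. *)
Lemma partial_sum_indep_future n : forall (J : seq nat) (A : nat -> set R) B,
  uniq J -> (forall i, i \in J -> (n < i)%N) ->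
  (forall i, measurable (A i)) -> measurable B ->
  P (partial_sum xi n @^-1` B `&` \bigcap_(i in [set` J]) (xi i @^-1` A i)) =
  (P (partial_sum xi n @^-1` B) * \prod_(i <- J) P (xi i @^-1` A i))%E.
Proof.
elim: n => [|n IH] J A B uJ Jn mA mB.
  have [B0|B0] := pselect (B 0).
  - have -> : partial_sum xi 0 @^-1` B = setT.
      by apply/seteqP; split => t //= _; rewrite partial_sum0.
    by rewrite setTI probability_setT mul1e xi_indep.
  - have -> : partial_sum xi 0 @^-1` B = set0.
      by apply/seteqP; split => t //=; rewrite partial_sum0.
    by rewrite set0I measure0 mul0e.
have rect (J' : seq nat) : uniq J' -> (forall i, i \in J' -> (n.+1 < i)%N) ->
    forall B1 B2, measurable B1 -> measurable B2 ->
    P (partial_sum xi n @^-1` B1 `&`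
       (xi n.+1 @^-1` B2 `&` \bigcap_(i in [set` J']) (xi i @^-1` A i))) =
    (P (partial_sum xi n @^-1` B1) * (P (xi n.+1 @^-1` B2) *
      \prod_(i <- J') P (xi i @^-1` A i)))%E.
  move=> uJ' J'n B1 B2 mB1 mB2.
  pose A' i := if i == n.+1 then B2 else A i.
  have nJ' : n.+1 \notin J' by apply/negP => /J'n; rewrite ltnn.
  have A'E i : i \in J' -> A' i = A i.
    by move=> iJ'; rewrite /A'; case: eqP => // ni; rewrite -ni iJ' in nJ'.
  have A'n : A' n.+1 = B2 by rewrite /A' eqxx.
  have bigE : \bigcap_(i in [set` n.+1 :: J']) (xi i @^-1` A' i) =
      xi n.+1 @^-1` B2 `&` \bigcap_(i in [set` J']) (xi i @^-1` A i).
    rewrite (_ : [set` n.+1 :: J'] = n.+1 |` [set` J']); last first.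
      apply/seteqP; split => k /=; rewrite inE.
        by move=> /predU1P[->|]; [left|right].
      by move=> [->|->]; rewrite ?eqxx ?orbT.
    by rewrite bigcap_setU1 A'n; congr (_ `&` _); apply: eq_bigcapr => k /= /A'E ->.
  have := IH (n.+1 :: J') A' B1.
  rewrite big_cons bigE A'n (eq_big_seq (fun i => P (xi i @^-1` A i))); last first.
    by move=> k kJ'; rewrite A'E.
  apply => //.
  - by rewrite /= nJ'.
  - by move=> i; rewrite inE => /predU1P[->//|/J'n]; exact: ltnW.
  - by move=> i; rewrite /A'; case: ifP.
have mE (J' : seq nat) : measurable (\bigcap_(i in [set` J']) (xi i @^-1` A i)).
  by apply: bigcap_measurableType => i _; exact: measurable_RV_preimage.
have sumE : partial_sum xi n.+1 @^-1` B =
    (fun t => (partial_sum xi n t, xi n.+1 t)) @^-1` sumset B.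
  by apply/seteqP; split => t /=; rewrite partial_sumS.
rewrite sumE (pair_law_of_rectangles (mE J) (rect J uJ Jn))//; last first.
  exact: measurable_sumset.
congr (_ * _)%E.
(* the empty block identifies the law of the sum itself *)
have := pair_law_of_rectangles (mE [::]) (rect [::] isT _) (measurable_sumset mB).
by rewrite set_nil bigcap_set0 setIT big_nil mule1 => ->.
Qed.

Lemma partial_sum_tail_rec n x :
  P (partial_sum xi n.+1 @^-1` `]x, +oo[) =
  (\int[distribution P (xi n.+1)]_y
    (tail (distribution P (partial_sum xi n)) (x - y))%:E)%E.
Proof.
have rect B1 B2 : measurable B1 -> measurable B2 ->
    P (xi n.+1 @^-1` B1 `&` (partial_sum xi n @^-1` B2 `&` setT)) =
    (P (xi n.+1 @^-1` B1) * (P (partial_sum xi n @^-1` B2) * 1))%E.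
  move=> mB1 mB2; rewrite setIT mule1 setIC muleC.
  have := @partial_sum_indep_future n [:: n.+1] (fun=> B1) B2 isT.
  rewrite set_cons1 bigcap_set1 big_seq1; apply => // i.
  by rewrite inE => /eqP ->.
have mx : measurable (`]x, +oo[%classic : set R) by exact: measurable_itv.
have := pair_law_of_rectangles measurableT rect (measurable_sumset mx).
rewrite setIT mule1.
rewrite (_ : _ @^-1` sumset _ = partial_sum xi n.+1 @^-1` `]x, +oo[); last first.
  by apply/seteqP; split => t /=; rewrite partial_sumS addrC.
move=> ->; rewrite /product_measure1; apply: eq_integral => y _ /=.
rewrite EFin_tail; congr (distribution P (partial_sum xi n) _).
apply/seteqP; split => s; rewrite /xsection/= inE /sumset/= !in_itv/= !andbT.
  by rewrite ltrBlDl.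
by rewrite ltrBlDl.
Qed.

End independence.

(** * Bounds for the tails of the sums *)

Section conclusion.
Context (R : realType) (d : measure_display) (Om : measurableType d).
Variables (P : probability Om R) (F : probability R R) (xi : nat -> {RV P >-> R}).
Hypotheses (xi_indep : mutually_independent xi)
  (xi_distr : identically_distributed xi F) (FS : Sstar F).
Local Notation T := (tail F).

Lemma tail_conv_ge0 n x : 0 <= tail_conv xi n x.
Proof. exact: tail_ge0. Qed.

Lemma tail_conv_le1 n x : tail_conv xi n x <= 1.
Proof. exact: tail_le1. Qed.

Lemma tail_convS n x :
  ((tail_conv xi n.+1 x)%:E = \int[F]_y (tail_conv xi n (x - y))%:E)%E.
Proof.
rewrite /tail_conv EFin_tail [LHS](partial_sum_tail_rec xi_indep).
by apply: eq_measure_integral => A mA _; exact: xi_distr.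
Qed.

(** Induction on n with [supersolution] above the level x0; below x0 the right-hand
    side is at least 1 as soon as K >= 1 / T(x0). *)
Lemma tail_conv_drift (c : R) : 0 <= c -> \int[F]_y y < c ->
  exists2 K, 0 < K & forall n x, (1 <= n)%N ->
    tail_conv xi n (x + c * n%:R) <= K * n%:R * T x.
Proof.
move=> c0 muc; have [x0 [C [delta [x00 C0 d0 step]]]] := supersolution FS c0 muc.
have bound n z : x0 <= z ->
    tail_conv xi n (z + c * n%:R) <= C * window F (n%:R * delta) z.
  elim: n z => [|n IH] z x0z.
    rewrite !(mulr0, mul0r) addr0 /window addr0 subrr mulr0.
    (* S 0 = 0 does not exceed z, as z >= x0 >= 0 *)
    have S0 : (P (partial_sum xi 0 @^-1` `]z, +oo[) = 0)%E.
      rewrite -(measure0 P); congr (P _); apply/seteqP; split => t //=.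
      by rewrite partial_sum0 in_itv/= andbT ltNge (le_trans x00).
    by rewrite -[leRHS]/(fine 0%E) -S0.
  rewrite -lee_fin tail_convS.
  rewrite (eq_integral (fun y : R => (tail_conv xi n (z + c - y + c * n%:R))%:E)); last first.
    by move=> y _; rewrite -natr1; congr (_%:E); congr tail_conv; ring.
  apply: (step n z (fun s => tail_conv xi n (s + c * n%:R))) => //.
  - apply: measurableT_comp; first exact: measurable_tail.
    exact: measurable_funD.
  - by move=> s; exact: tail_conv_ge0.
  - by move=> s; exact: tail_conv_le1.
have Tx0 : 0 < T x0 by exact: Sstar_tail_gt0.
exists (Num.max (C * delta) (T x0)^-1).
  by rewrite lt_max invr_gt0 Tx0 orbT.
move=> n x n1; have n1R : 1 <= n%:R :> R by rewrite ler1n.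
have [x0x|xx0] := leP x0 x.
  apply: le_trans (bound n x x0x) _.
  have x_ge0 : 0 <= x by lra.
  have nd : 0 <= n%:R * delta by rewrite mulr_ge0// ltW.
  have xn : x <= x + n%:R * delta by lra.
  have := itail_le F x_ge0 xn; rewrite -/(window _ _ _) (addrC x) addrK => h.
  have := ler_wpM2l C0 h => /le_trans; apply.
  rewrite [leRHS](_ : _ = Num.max (C * delta) (T x0)^-1 * (n%:R * T x)); last by ring.
  rewrite [leLHS](_ : _ = C * delta * (n%:R * T x)); last by ring.
  by rewrite ler_wpM2r ?mulr_ge0 ?tail_ge0// le_max lexx.
rewrite (le_trans (tail_conv_le1 _ _))//.
apply: (@le_trans _ _ ((T x0)^-1 * n%:R * T x)); last first.
  by rewrite ler_wpM2r ?tail_ge0// ler_wpM2r// le_max lexx orbT.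
rewrite mulrAC -[leLHS]mulr1 ler_pM//.
by rewrite mulrC ler_pdivlMr// mul1r tail_nincr// ltW.
Qed.

Lemma tail_conv_max n x : tail_conv xi n x / T x <= (T x)^-1.
Proof.
by rewrite ler_pdivrMr ?Sstar_tail_gt0// mulVf ?tail_conv_le1// gt_eqF ?Sstar_tail_gt0.
Qed.

End conclusion.

Theorem theorem2 (R : realType) (d : measure_display) (T : measurableType d)
  (P : probability T R) (F : probability R R) (xi : nat -> {RV P >-> R})
  (xi_indep : mutually_independent xi)
  (xi_distr : identically_distributed xi F)
  (xi_mean : P.-integrable setT (fun t => (xi 0%N t)%:E))
  (F_Sstar : Sstar F) :
  (('E_P[xi 0%N] < 0)%E ->
     exists K : R, forall (n : nat) (x : R), (1 <= n)%N ->
       tail_conv xi n x / tail F x <= K * n%:R)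
  /\
  ((0 <= 'E_P[xi 0%N] < +oo)%E ->
     forall c : R, ('E_P[xi 0%N] < c%:E)%E ->
       exists K : R, forall (n : nat) (x : R), (1 <= n)%N ->
         tail_conv xi n x / tail F x <= K / tail F (c * n%:R)).
Proof.
have [intF _ _] := F_Sstar.
have EF : ('E_P[xi 0%N] = (\int[F]_y y)%:E)%E.
  rewrite (EFin_Rintegral measurableT intF) expectation_def.
  rewrite -(integral_distribution (f := EFin))//.
  by apply: eq_measure_integral => A mA _; exact: xi_distr.
have T0 := Sstar_tail_gt0 F_Sstar.
rewrite EF !lte_fin lee_fin; split=> [mu0|/andP[mu0 _] c].
  have [K K0 KP] := tail_conv_drift xi_indep xi_distr F_Sstar (lexx 0) mu0.
  exists K => n x n1; have := KP n x n1.
  by rewrite mul0r addr0 ler_pdivrMr.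
rewrite lte_fin => muc.
pose c' := (\int[F]_y y + c) / 2.
have c'0 : 0 <= c' by rewrite /c'; lra.
have muc' : \int[F]_y y < c' by rewrite /c'; lra.
have c'c : c' < c by rewrite /c'; lra.
have [K K0 KP] := tail_conv_drift xi_indep xi_distr F_Sstar c'0 muc'.
have [B B0 BP] := Sstar_itailcv_bounded F_Sstar.
exists (Num.max 1 (K * B / (c - c'))) => n x n1.
have n1R : 1 <= n%:R :> R by rewrite ler1n.
have [xcn|cnx] := leP x (c * n%:R).
  apply: (le_trans (tail_conv_max xi F_Sstar n x)).
  rewrite -[leLHS]mul1r ler_pM ?invr_ge0 ?tail_ge0//.
    by rewrite le_max lexx.
  by rewrite lef_pV2 ?posrE// tail_nincr.
have cn : c' * n%:R <= c * n%:R by rewrite ler_wpM2r//; lra.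
have c'n0 : 0 <= c' * n%:R by rewrite mulr_ge0.
have x0 : 0 <= x by lra.
have cc : 0 < c - c' by lra.
have tail_le := KP n (x - c' * n%:R) n1; rewrite subrK in tail_le.
(* the convolution integral over [c' n, c n] absorbs the factor n *)
have mid_le : (c * n%:R - c' * n%:R) * (tail F (x - c' * n%:R) * tail F (c * n%:R))
    <= B * tail F x.
  apply: le_trans (itailcv_ge_mul F x cn) _.
  apply: le_trans _ (BP x x0).
  rewrite (@itailcv_split _ F 0 (c' * n%:R) x)//; last by lra.
  rewrite (@itailcv_split _ F (c' * n%:R) (c * n%:R) x)//; last by lra.
  by rewrite addrCA ler_wpDr// addr_ge0// itailcv_ge0.
have Tx := T0 x; have Tcn := T0 (c * n%:R).
rewrite ler_pdivrMr// mulrAC ler_pdivlMr// -(ler_pM2r cc).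
apply: (@le_trans _ _ (K * (B * tail F x))).
  have h1 := ler_wpM2l (ltW K0) mid_le.
  have h2 := ler_wpM2r (mulr_ge0 (ltW Tcn) (ltW cc)) tail_le.
  lra.
have : K * B / (c - c') * (c - c') * tail F x <=
    Num.max 1 (K * B / (c - c')) * (c - c') * tail F x.
  by rewrite ler_wpM2r ?(ltW Tx)// ler_wpM2r ?(ltW cc)// le_max lexx orbT.
rewrite mulfVK; last by rewrite gt_eqF.
lra.
Qed.
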